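(* Let $\Omega$ be a locally compact Hausdorff space, $G$ a group and $\rho \colon G \to \mathrm{Aut}^+_s(C_0(\Omega))$ a positive representation with compact image. Then there exist a unique isometric positive representation $\pi \colon G \to \mathrm{Homeo}(\Omega)$ and an $m \in C_b(\Omega)^{++}$ such that \[ \rho_s = m \pi_s m^{-1} \quad \text{for all } s \in G. \] The image of $\pi$ is compact. Conversely, any positive representation $\pi \colon G \to \mathrm{Homeo}(\Omega)$ with compact image and any $m \in C_b(\Omega)^{++}$ define a positive representation $\rho$ with compact image by $\rho_s := m \pi_s m^{-1}$ for all $s \in G$. In this correspondence between $\rho$ and $\pi$ (when $G$ is a topological group), $\rho$ is strongly continuous if and only if $\pi$ is strongly continuous. Moreover, if $\rho^1 = m_1 \pi^1 m_1^{-1}$ and $\rho^2 = m_2 \pi^2 m_2^{-1}$ are two positive representations of $G$ in $C_0(\Omega)$ with compact image, where $\pi^1,\pi^2\colon G\to \mathrm{Homeo}(\Omega)$ are isometric positive representations with compact image and $m_1, m_2 \in C_b(\Omega)^{++}$, then $\rho^1$ and $\rho^2$ are order equivalent if and only if $\pi^1$ and $\pi^2$ are isometrically order equivalent.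
   Context: $C_0(\Omega)$ is the Banach lattice of real-valued continuous functions on $\Omega$ vanishing at infinity, with the supremum norm. $\mathrm{Aut}^+_s(C_0(\Omega))$ is the group $\mathrm{Aut}^+(C_0(\Omega))$ of lattice automorphisms of $C_0(\Omega)$ with the strong operator topology. $\mathrm{Homeo}(\Omega)$ is the group of homeomorphisms of $\Omega$, identified with a subgroup of $\mathrm{Aut}^+_s(C_0(\Omega))$ (namely the group of isometric lattice automorphisms) via $\phi x := x\circ\phi^{-1}$ for $x\in C_0(\Omega)$, and equipped with the strong operator topology. $C_b(\Omega)^{++}$ is the set of bounded continuous functions $m$ on $\Omega$ for which there is a $\delta>0$ with $m(\omega)\ge\delta$ for all $\omega\in\Omega$; such $m$ is identified with the operator of pointwise multiplication by $m$ on $C_0(\Omega)$. A positive representation of a group $G$ in a Banach lattice $E$ is a group homomorphism $\rho\colon G \to \mathrm{Aut}^+(E)$, and $\rho_s := \rho(s)$; it is strongly continuous if it is continuous for the strong operator topology, and compactness of the image is with respect to that topology. The notation $\rho = m\pi m^{-1}$ means $\rho_s=m\pi_sm^{-1}$ for all $s \in G$. Two positive representations $\rho,\theta$ of $G$ in $E$ are order equivalent if there is a lattice automorphism $T$ of $E$ with $T\rho_s=\theta_sT$ for all $s\in G$; they are isometrically order equivalent if $T$ can be chosen to be an isometric lattice automorphism. *)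

(* Defs.v *)
From HB Require Import structures.
From mathcomp Require Import all_boot all_order all_algebra.
From mathcomp Require Import all_classical all_reals all_analysis.
Import numFieldNormedType.Exports.
Import Order.TTheory GRing.Theory Num.Theory.

Set Implicit Arguments.
Unset Strict Implicit.
Unset Printing Implicit Defensive.

Local Open Scope classical_set_scope.
Local Open Scope ring_scope.

Section C0_predicate.
Variables (R : realType) (Omega : topologicalType).
Implicit Types f g h : Omega -> R.

Definition vanishes_at_infinity f :=
  forall e : R, 0 < e -> compact [set w | e <= `|f w|].

Definition c0_pred : {pred Omega -> R} :=
  [pred f | `[< continuous f /\ vanishes_at_infinity f >]].

Lemma c0_predP f :
  reflect (continuous f /\ vanishes_at_infinity f) (f \in c0_pred).
Proof. exact: asboolP. Qed.

Lemma c0_dominated f g h (a : R) : continuous h ->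
  f \in c0_pred -> g \in c0_pred -> 0 < a ->
  (forall w, `|h w| <= a * (`|f w| + `|g w|)) -> h \in c0_pred.
Proof.
move=> ch /c0_predP[_ vf] /c0_predP[_ vg] a0 hfg; apply/c0_predP; split=> // e e0.
pose d := e / a / 2.
have d0 : 0 < d by rewrite !divr_gt0.
apply: (subclosed_compact _ (compactU (vf d d0) (vg d d0))).
  have cnh : continuous (fun w => `|h w|).
    by move=> w; apply: continuous_comp; [exact: ch|exact: norm_continuous].
  exact: (continuous_closedP (fun w => `|h w|)).1 cnh _ (@closed_ge _ e).
move=> w /= ew; have [|fd] := leP d `|f w|; first by left.
have [|gd] := leP d `|g w|; first by right.
suff : e < e by rewrite ltxx.
apply: (le_lt_trans ew); apply: (le_lt_trans (hfg w)).
have -> : e = a * (d + d).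
  by rewrite -splitr mulrC divfK// gt_eqF.
by rewrite ltr_pM2l// ltrD.
Qed.

Lemma c0_submod_closed : submod_closed c0_pred.
Proof.
have c00 : (0 : Omega -> R) \in c0_pred.
  apply/c0_predP; split; first exact: cst_continuous.
  move=> e e0; have -> : [set w | e <= `|(0 : Omega -> R) w|] = set0; last exact: compact0.
  by apply/seteqP; split=> // w /=; rewrite normr0 leNgt e0.
split=> // a f g fc gc.
apply: (@c0_dominated f g _ (`|a| + 1)) => //.
- move/c0_predP: fc => [cf _]; move/c0_predP: gc => [cg _] w.
  by apply: cvgD; [apply: cvgZr; exact: cf|exact: cg].
- move=> w; rewrite (le_trans (ler_normD _ _))// normrM mulrDr lerD//.
    by rewrite ler_wpM2r// lerDl.
  by rewrite ler_peMl// lerDr.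
Qed.

HB.instance Definition _ :=
  GRing.isSubmodClosed.Build R (Omega -> R) c0_pred c0_submod_closed.

Lemma c0_meet_closed : Order.ClosedPredicates.meet_closed c0_pred.
Proof.
move=> f g fc gc; apply: (@c0_dominated f g _ 1) => //.
- move/c0_predP: fc => [cf _]; move/c0_predP: gc => [cg _] w.
  rewrite (_ : (f `&` g)%O = (fun w => Num.min (f w) (g w))).
    exact: (continuous_min (cf w) (cg w)).
  by apply/funext => z; rewrite meetfE meetEtotal.
- move=> w; rewrite mul1r meetfE meetEtotal.
  by case: (leP (f w) (g w)) => _; rewrite (lerDl, lerDr).
Qed.

Lemma c0_join_closed : Order.ClosedPredicates.join_closed c0_pred.
Proof.
move=> f g fc gc; apply: (@c0_dominated f g _ 1) => //.
- move/c0_predP: fc => [cf _]; move/c0_predP: gc => [cg _] w.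
  rewrite (_ : (f `|` g)%O = (fun w => Num.max (f w) (g w))).
    exact: (continuous_max (cf w) (cg w)).
  by apply/funext => z; rewrite joinfE joinEtotal.
- move=> w; rewrite mul1r joinfE joinEtotal.
  by case: (leP (f w) (g w)) => _; rewrite (lerDl, lerDr).
Qed.

HB.instance Definition _ := Order.isLatticeClosed.Build _ (Omega -> R) c0_pred
  c0_meet_closed c0_join_closed.

End C0_predicate.

Record C0 (R : realType) (Omega : topologicalType) := C0Fun {
  c0_fun :> Omega -> R;
  c0_funP : c0_fun \in @c0_pred R Omega
}.

HB.instance Definition _ (R : realType) (Omega : topologicalType) :=
  [isSub of C0 R Omega for @c0_fun R Omega].
HB.instance Definition _ (R : realType) (Omega : topologicalType) :=
  [Choice of C0 R Omega by <:].
HB.instance Definition _ (R : realType) (Omega : topologicalType) :=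
  [SubChoice_isSubLmodule of C0 R Omega by <:].
HB.instance Definition _ (R : realType) (Omega : topologicalType) :=
  [SubChoice_isSubLattice of C0 R Omega by <: with FunOrder.fun_display].

Section C0_norm.
Variables (R : realType) (Omega : topologicalType).
Implicit Types f g : C0 R Omega.

Definition c0_norm f : R := sup [set `|f w| | w in [set: Omega]].

Lemma c0_bounded f : has_ubound [set `|f w| | w in [set: Omega]].
Proof.
have /c0_predP[cf /(_ _ ltr01) vf] := c0_funP f.
have := continuous_compact (continuous_subspaceT cf) vf.
move=> /compact_bounded[M [Mr bM]].
exists (Num.max 1 (M + 1)) => _ [w _ <-].
have [fw|/ltW fw] := leP 1 `|f w|; last by rewrite le_max fw.
by rewrite le_max; apply/orP; right; apply: bM; [rewrite ltrDl|exists w].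
Qed.

Lemma c0_norm_ub f w : `|f w| <= c0_norm f.
Proof. by apply: (ub_le_sup (c0_bounded f)); exists w. Qed.

Lemma c0_norm_ge0 f : 0 <= c0_norm f.
Proof.
have [[w _]|/set0P/negP/negPn/eqP T0] := pselect ([set: Omega] !=set0).
  exact: le_trans (normr_ge0 _) (c0_norm_ub f w).
by rewrite /c0_norm T0 image_set0 sup0.
Qed.

Lemma c0_norm_le f (M : R) : 0 <= M -> (forall w, `|f w| <= M) ->
  c0_norm f <= M.
Proof.
move=> M0 fM.
have [[w _]|/set0P/negP/negPn/eqP T0] := pselect ([set: Omega] !=set0).
  by apply: ge_sup; [exists `|f w|, w|move=> _ [z _ <-]].
by rewrite /c0_norm T0 image_set0 sup0.
Qed.

Lemma c0_normD f g : c0_norm (f + g) <= c0_norm f + c0_norm g.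
Proof.
apply: c0_norm_le; first by rewrite addr_ge0// c0_norm_ge0.
move=> w; rewrite (le_trans (ler_normD (f w) (g w)))//.
by rewrite lerD// c0_norm_ub.
Qed.

Lemma c0_normZ (a : R) f : c0_norm (a *: f) = `|a| * c0_norm f.
Proof.
have le b h : c0_norm (b *: h) <= `|b| * c0_norm h.
  apply: c0_norm_le; first by rewrite mulr_ge0// c0_norm_ge0.
  move=> w; rewrite -[(b *: h) w]/(b * h w) normrM.
  by rewrite ler_wpM2l// c0_norm_ub.
have [->|a0] := eqVneq a 0.
  by apply/le_anti; rewrite le normr0 mul0r c0_norm_ge0.
apply/le_anti; rewrite le/= -ler_pdivlMl ?normr_gt0//.
by rewrite -normfV -{1}(scalerK a0 f) le.
Qed.

Lemma c0_norm_eq0 f : c0_norm f = 0 -> f = 0.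
Proof.
move=> f0; apply/val_inj/funext => w /=; apply/eqP.
by rewrite -[X in _ == X]/(0 : R) -normr_le0 -f0 c0_norm_ub.
Qed.

HB.instance Definition _ :=
  Lmodule_isNormed.Build R (C0 R Omega) c0_normD c0_normZ c0_norm_eq0.

End C0_norm.

(* Lattice automorphisms are not required to be isometric; continuity is
   automatic for lattice homomorphisms between Banach lattices. *)
Record latAut (R : realType) (Omega : topologicalType) := LatAut {
  aut_fun :> C0 R Omega -> C0 R Omega;
  aut_inv : C0 R Omega -> C0 R Omega;
  aut_linear : linear aut_fun;
  aut_meet : {morph aut_fun : f g / (f `&` g)%O};
  aut_join : {morph aut_fun : f g / (f `|` g)%O};
  aut_funK : cancel aut_fun aut_inv;
  aut_invK : cancel aut_inv aut_fun
}.

Section latAut_group.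
Variables (R : realType) (Omega : topologicalType).
Implicit Types T U V : latAut R Omega.

Lemma autP T U : aut_fun T =1 aut_fun U -> T = U.
Proof.
case: T U => [T Ti Tl Tm Tj TK KT] [U Ui Ul Um Uj UK KU] /= /funext TU.
subst U; have TiUi : Ti = Ui by apply/funext => f; rewrite -{1}(KU f) TK.
by subst Ui; congr LatAut; exact: Prop_irrelevance.
Qed.

HB.instance Definition _ := gen_eqMixin (latAut R Omega).
HB.instance Definition _ := gen_choiceMixin (latAut R Omega).

Definition aut_one : latAut R Omega :=
  @LatAut R Omega id id (fun _ _ _ => erefl) (fun _ _ => erefl)
    (fun _ _ => erefl) (fun _ => erefl) (fun _ => erefl).

Section Mul.
Variables T U : latAut R Omega.

Lemma aut_mul_linear : linear (T \o U).
Proof. by move=> a f g /=; rewrite !aut_linear. Qed.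
Lemma aut_mul_meet : {morph T \o U : f g / (f `&` g)%O}.
Proof. by move=> f g /=; rewrite !aut_meet. Qed.
Lemma aut_mul_join : {morph T \o U : f g / (f `|` g)%O}.
Proof. by move=> f g /=; rewrite !aut_join. Qed.

Definition aut_mul : latAut R Omega :=
  LatAut aut_mul_linear aut_mul_meet aut_mul_join
    (can_comp (@aut_funK _ _ T) (@aut_funK _ _ U))
    (can_comp (@aut_invK _ _ U) (@aut_invK _ _ T)).

Let T_inj := can_inj (@aut_funK _ _ T).

Lemma aut_inv_linear : linear (aut_inv T).
Proof. by move=> a f g; apply: T_inj; rewrite aut_linear !aut_invK. Qed.
Lemma aut_inv_meet : {morph aut_inv T : f g / (f `&` g)%O}.
Proof. by move=> f g; apply: T_inj; rewrite aut_meet !aut_invK. Qed.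
Lemma aut_inv_join : {morph aut_inv T : f g / (f `|` g)%O}.
Proof. by move=> f g; apply: T_inj; rewrite aut_join !aut_invK. Qed.

Definition aut_inverse : latAut R Omega :=
  LatAut aut_inv_linear aut_inv_meet aut_inv_join
    (@aut_invK _ _ T) (@aut_funK _ _ T).

End Mul.

Lemma aut_mulA : associative aut_mul.
Proof. by move=> T U V; exact: autP. Qed.
Lemma aut_1mul : left_id aut_one aut_mul.
Proof. by move=> T; exact: autP. Qed.
Lemma aut_mul1 : right_id aut_one aut_mul.
Proof. by move=> T; exact: autP. Qed.
Lemma aut_Vmul : left_inverse aut_one aut_inverse aut_mul.
Proof. by move=> T; apply: autP => f; exact: aut_funK. Qed.
Lemma aut_mulV : right_inverse aut_one aut_inverse aut_mul.
Proof. by move=> T; apply: autP => f; exact: aut_invK. Qed.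

HB.instance Definition _ := isGroup.Build (latAut R Omega)
  aut_mulA aut_1mul aut_mul1 aut_Vmul aut_mulV.

(* The strong operator topology is the topology of pointwise convergence in
   norm, restricted to the automorphisms. *)
Definition aut_ptws T : {ptws C0 R Omega -> C0 R Omega} := aut_fun T.

HB.instance Definition _ :=
  Topological.copy (latAut R Omega) (initial_topology aut_ptws).

Definition isometric T := forall f, `|T f| = `|f|.

End latAut_group.

Record Homeo (Omega : topologicalType) := MkHomeo {
  homeo_fun :> Omega -> Omega;
  homeo_inv : Omega -> Omega;
  homeo_continuous : continuous homeo_fun;
  homeo_inv_continuous : continuous homeo_inv;
  homeo_funK : cancel homeo_fun homeo_inv;
  homeo_invK : cancel homeo_inv homeo_fun
}.

Section Homeo_group.
Variable Omega : topologicalType.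
Implicit Types p q : Homeo Omega.

Lemma homeoP p q : homeo_fun p =1 homeo_fun q -> p = q.
Proof.
case: p q => [p pi pc pic pK Kp] [q qi qc qic qK Kq] /= /funext pq.
subst q; have piqi : pi = qi by apply/funext => w; rewrite -{1}(Kq w) pK.
by subst qi; congr MkHomeo; exact: Prop_irrelevance.
Qed.

HB.instance Definition _ := gen_eqMixin (Homeo Omega).
HB.instance Definition _ := gen_choiceMixin (Homeo Omega).

Definition homeo_one : Homeo Omega :=
  @MkHomeo Omega id id (fun _ => cvg_id) (fun _ => cvg_id)
    (fun _ => erefl) (fun _ => erefl).

Definition homeo_mul p q : Homeo Omega :=
  MkHomeo
    (fun w => continuous_comp (@homeo_continuous _ q w)
      (@homeo_continuous _ p (q w)))
    (fun w => continuous_comp (@homeo_inv_continuous _ p w)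
      (@homeo_inv_continuous _ q (homeo_inv p w)))
    (can_comp (@homeo_funK _ p) (@homeo_funK _ q))
    (can_comp (@homeo_invK _ q) (@homeo_invK _ p)).

Definition homeo_inverse p : Homeo Omega :=
  MkHomeo (@homeo_inv_continuous _ p) (@homeo_continuous _ p)
    (@homeo_invK _ p) (@homeo_funK _ p).

Lemma homeo_mulA : associative homeo_mul.
Proof. by move=> p q r; exact: homeoP. Qed.
Lemma homeo_1mul : left_id homeo_one homeo_mul.
Proof. by move=> p; exact: homeoP. Qed.
Lemma homeo_mul1 : right_id homeo_one homeo_mul.
Proof. by move=> p; exact: homeoP. Qed.
Lemma homeo_Vmul : left_inverse homeo_one homeo_inverse homeo_mul.
Proof. by move=> p; apply: homeoP => w; exact: homeo_funK. Qed.
Lemma homeo_mulV : right_inverse homeo_one homeo_inverse homeo_mul.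
Proof. by move=> p; apply: homeoP => w; exact: homeo_invK. Qed.

HB.instance Definition _ := isGroup.Build (Homeo Omega)
  homeo_mulA homeo_1mul homeo_mul1 homeo_Vmul homeo_mulV.

End Homeo_group.

Section Homeo_action.
Variables (R : realType) (Omega : topologicalType).
Implicit Types (p q : Homeo Omega) (f g : C0 R Omega).

Lemma c0_homeo p f : (f \o homeo_inv p) \in @c0_pred R Omega.
Proof.
have /c0_predP[cf vf] := c0_funP f; apply/c0_predP; split.
  by move=> w; apply: continuous_comp;
    [exact: homeo_inv_continuous|exact: cf].
move=> e e0.
have cp : {within [set w | e <= `|f w|], continuous (homeo_fun p)}.
  exact/continuous_subspaceT/homeo_continuous.
have -> : [set w | e <= `|(f \o homeo_inv p) w|] =
    homeo_fun p @` [set w | e <= `|f w|].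
  apply/seteqP; split=> [w /= ew|_ [w /= ew <-]]; last by rewrite homeo_funK.
  by exists (homeo_inv p w) => //; rewrite homeo_invK.
exact: (continuous_compact cp (vf e e0)).
Qed.

Definition homeo_op p f : C0 R Omega := C0Fun (c0_homeo p f).

Lemma homeo_op_linear p : linear (homeo_op p).
Proof. by move=> a f g; apply/val_inj/funext. Qed.
Lemma homeo_op_meet p : {morph homeo_op p : f g / (f `&` g)%O}.
Proof. by move=> f g; apply/val_inj/funext. Qed.
Lemma homeo_op_join p : {morph homeo_op p : f g / (f `|` g)%O}.
Proof. by move=> f g; apply/val_inj/funext. Qed.
Lemma homeo_opK p : cancel (homeo_op p) (homeo_op (homeo_inverse p)).
Proof. by move=> f; apply/val_inj/funext => w /=; rewrite homeo_funK. Qed.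
Lemma homeo_opKV p : cancel (homeo_op (homeo_inverse p)) (homeo_op p).
Proof. by move=> f; apply/val_inj/funext => w /=; rewrite homeo_invK. Qed.

End Homeo_action.

(* The identification of Homeo Omega with a group of lattice automorphisms. *)
Definition homeo_aut (R : realType) (Omega : topologicalType)
    (p : Homeo Omega) : latAut R Omega :=
  LatAut (@homeo_op_linear R _ p) (@homeo_op_meet R _ p) (@homeo_op_join R _ p)
    (@homeo_opK R _ p) (@homeo_opKV R _ p).

(* Homeo Omega with the strong operator topology; the topology is defined
   through C0 R Omega, so the alias carries R. *)
Definition homeo_s (R : realType) (Omega : topologicalType) : Type :=
  Homeo Omega.

HB.instance Definition _ (R : realType) (Omega : topologicalType) :=
  Group.on (homeo_s R Omega).
HB.instance Definition _ (R : realType) (Omega : topologicalType) :=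
  Topological.copy (homeo_s R Omega)
    (initial_topology (@homeo_aut R Omega)).

Lemma homeo_autM (R : realType) (Omega : topologicalType) :
  {morph (@homeo_aut R Omega : homeo_s R Omega -> latAut R Omega) :
    p q / (p * q)%g}.
Proof. by move=> p q; apply: autP => f; exact/val_inj/funext. Qed.

Lemma homeo_aut_isometric (R : realType) (Omega : topologicalType)
  (p : homeo_s R Omega) : isometric (homeo_aut R p).
Proof.
move=> f; rewrite -[LHS]/(c0_norm _) -[RHS]/(c0_norm _).
apply/le_anti/andP; split; apply: c0_norm_le (c0_norm_ge0 _) _ => w.
  exact: (c0_norm_ub f (homeo_inv p w)).
by rewrite -(homeo_funK p w); exact: (c0_norm_ub (homeo_aut R p f)).
Qed.

Record Cbpp (R : realType) (Omega : topologicalType) := MkCbpp {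
  cbpp_fun :> Omega -> R;
  cbpp_continuous : continuous cbpp_fun;
  cbpp_bounded : [bounded cbpp_fun w | w in [set: Omega]];
  cbpp_ge : exists2 d : R, 0 < d & forall w, d <= cbpp_fun w
}.

Section Multiplication.
Variables (R : realType) (Omega : topologicalType) (m : Cbpp R Omega).
Implicit Types f g : C0 R Omega.

Lemma cbpp_gt0 w : 0 < m w.
Proof. by have [d d0 /(_ w)] := cbpp_ge m; exact: lt_le_trans. Qed.

Lemma c0_mul f : (fun w => m w * f w) \in @c0_pred R Omega.
Proof.
have [M [Mr bM]] := cbpp_bounded m.
apply: (@c0_dominated _ _ f f _ (`|M| + 1)); rewrite ?c0_funP ?ltr_pwDr//.
  have /c0_predP[cf _] := c0_funP f.
  by move=> w; apply: cvgM; [exact: cbpp_continuous|exact: cf].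
move=> w; rewrite normrM ler_pM// ?lerDl//.
by apply: bM => //; rewrite ltr_pwDr// ler_norm.
Qed.

Lemma c0_div f : (fun w => (m w)^-1 * f w) \in @c0_pred R Omega.
Proof.
have [d d0 dm] := cbpp_ge m.
apply: (@c0_dominated _ _ f f _ d^-1); rewrite ?c0_funP ?invr_gt0//.
  have /c0_predP[cf _] := c0_funP f.
  move=> w; apply: cvgM; last exact: cf.
  by apply: cvgV; [rewrite gt_eqF ?cbpp_gt0|exact: cbpp_continuous].
move=> w; rewrite normrM ler_pM// ?lerDl// gtr0_norm ?invr_gt0 ?cbpp_gt0//.
by rewrite lef_pV2 ?posrE ?cbpp_gt0.
Qed.

Definition mul_op f : C0 R Omega := C0Fun (c0_mul f).
Definition div_op f : C0 R Omega := C0Fun (c0_div f).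

Lemma mul_op_linear : linear mul_op.
Proof.
move=> a f g; apply/val_inj/funext => w.
rewrite -[LHS]/(m w * (a * f w + g w)) -[RHS]/(a * (m w * f w) + m w * g w).
by rewrite mulrDr mulrCA.
Qed.
Lemma mul_op_meet : {morph mul_op : f g / (f `&` g)%O}.
Proof.
move=> f g; apply/val_inj/funext => w.
rewrite -[LHS]/(m w * (f w `&` g w)%O) -[RHS]/((m w * f w) `&` (m w * g w))%O.
by rewrite !meetEtotal minr_pMr// ltW// cbpp_gt0.
Qed.
Lemma mul_op_join : {morph mul_op : f g / (f `|` g)%O}.
Proof.
move=> f g; apply/val_inj/funext => w.
rewrite -[LHS]/(m w * (f w `|` g w)%O) -[RHS]/((m w * f w) `|` (m w * g w))%O.
by rewrite !joinEtotal maxr_pMr// ltW// cbpp_gt0.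
Qed.
Lemma mul_opK : cancel mul_op div_op.
Proof.
by move=> f; apply/val_inj/funext => w /=; rewrite mulKf// gt_eqF// cbpp_gt0.
Qed.
Lemma mul_opKV : cancel div_op mul_op.
Proof.
by move=> f; apply/val_inj/funext => w /=; rewrite mulVKf// gt_eqF// cbpp_gt0.
Qed.

Definition mul_aut : latAut R Omega :=
  LatAut mul_op_linear mul_op_meet mul_op_join mul_opK mul_opKV.

End Multiplication.

Definition group_morphism (G H : groupType) (r : G -> H) : Prop :=
  {morph r : s t / (s * t)%g}.

Definition conj_rep (R : realType) (Omega : topologicalType) (G : groupType)
    (m : Cbpp R Omega) (pi : G -> homeo_s R Omega) (s : G) : latAut R Omega :=
  (mul_aut m * homeo_aut R (pi s) * (mul_aut m)^-1)%g.

Definition order_equivalent (R : realType) (Omega : topologicalType)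
    (G : groupType) (r1 r2 : G -> latAut R Omega) : Prop :=
  exists T : latAut R Omega, forall s, (T * r1 s = r2 s * T)%g.

Definition isometrically_order_equivalent (R : realType)
    (Omega : topologicalType) (G : groupType)
    (r1 r2 : G -> latAut R Omega) : Prop :=
  exists2 T : latAut R Omega, isometric T & forall s, (T * r1 s = r2 s * T)%g.

HB.mixin Record isTopologicalGroup G & Topological G & Group G := {
  mulg_continuous : continuous (fun x : G * G => (x.1 * x.2)%g);
  invg_continuous : continuous (fun x : G => (x^-1)%g)
}.

#[short(type="topologicalGroupType")]
HB.structure Definition TopologicalGroup :=
  {G of Topological G & Group G & isTopologicalGroup G}.

(* Main.v *)
(* By a Riesz-type description of the lattice homomorphisms [C0 -> R], every
   lattice automorphism is a weighted composition [T f w = c_T w * f (q_T w)]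
   with [c_T > 0], and [(T, w) |-> c_T w], [(T, w) |-> q_T w] are jointly
   continuous for the strong operator topology. The weights satisfy the cocycle
   identity [c_(T U) w = c_T w * c_U (q_T w)], and a gliding hump argument
   bounds them uniformly over a compact set of automorphisms. Hence, for a
   compact group [H] of automorphisms, [m := sup_(T in H) c_T] is continuous and bounded
   and satisfies [m w = c_T w * m (q_T w)], that is, [T = m (_ \o q_T) m^-1]:
   the cocycle is a coboundary, and no averaging over [H] is needed. Everything
   else follows from the uniqueness of [q_T] and from the continuity of
   [V |-> T V U]. *)
Require Import Defs.
From HB Require Import structures.
From mathcomp Require Import all_boot all_order all_algebra.
From mathcomp Require Import all_classical all_reals all_analysis.
From mathcomp Require Import ring lra.
Import numFieldNormedType.Exports.
Import Order.TTheory GRing.Theory Num.Theory.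

Set Implicit Arguments.
Unset Strict Implicit.
Unset Printing Implicit Defensive.

Local Open Scope classical_set_scope.
Local Open Scope ring_scope.

(** * Square roots and uniform limits in [C0] *)

Section C0_functions.
Variables (R : realType) (Omega : topologicalType).
Implicit Types (f g h : C0 R Omega) (w : Omega).

Lemma c0_joinE f g w : (f `|` g)%O w = Num.max (f w) (g w).
Proof. by rewrite -[LHS]/((f w `|` g w)%O) joinEtotal. Qed.

Lemma c0_scaleE (a : R) f w : (a *: f) w = a * f w.
Proof. by []. Qed.

Lemma c0_continuous f : continuous f.
Proof. by have /c0_predP[] := c0_funP f. Qed.

(** Since [e <= sqrt (f w)] exactly when [e ^+ 2 <= f w], superlevel sets of the root are superlevel
    sets of [f]. *)
Lemma c0_sqrt f : (forall w, 0 <= f w) ->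
  (fun w => Num.sqrt (f w)) \in @c0_pred R Omega.
Proof.
move=> f0; have /c0_predP[cf vf] := c0_funP f; apply/c0_predP; split.
  by move=> w; apply: continuous_comp; [exact: cf|exact: sqrt_continuous].
move=> e e0; have := vf _ (exprn_gt0 2 e0); congr compact.
apply/seteqP; split=> w /=; rewrite !ger0_norm ?sqrtr_ge0// => ew.
  by rewrite -(ger0_norm (ltW e0)) -sqrtr_sqr ler_sqrt.
by rewrite -(sqr_sqrtr (f0 w)) lerXn2r// ?nnegrE ?sqrtr_ge0// ltW.
Qed.

(** Where [|F| >= e], an [e / 2]-close [g] has [|g| >= e / 2], which confines the superlevel set to
    a compact one. *)
Lemma c0_uniform_limit (F : Omega -> R) :
  (forall e : R, 0 < e -> exists g, forall w, `|F w - g w| <= e) ->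
  F \in @c0_pred R Omega.
Proof.
move=> FP; have cF : continuous F.
  move=> w; apply/cvgrPdist_le => e e0.
  have [|g gF] := FP (e / 3); first by rewrite divr_gt0.
  have /cvgrPdist_le/(_ (e / 3)) := @c0_continuous g w.
  rewrite divr_gt0// => /(_ erefl); apply: filterS => z gwz.
  have -> : F w - F z = (F w - g w) + (g w - g z) - (F z - g z) by ring.
  rewrite (le_trans (ler_normB _ _))//.
  have := ler_normD (F w - g w) (g w - g z).
  have := gF w; have := gF z; lra.
apply/c0_predP; split=> // e e0.
have [|g gF] := FP (e / 2); first by rewrite divr_gt0.
have /c0_predP[_ vg] := c0_funP g.
have e2 : 0 < e / 2 by rewrite divr_gt0.
apply: (subclosed_compact _ (vg _ e2)).
  have cnF : continuous (fun w => `|F w|).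
    by move=> w; apply: cvg_norm; exact: cF.
  exact: (continuous_closedP (fun w => `|F w|)).1 cnF _ (@closed_ge _ e).
move=> w /= ew; have := gF w; have := ler_normD (F w - g w) (g w).
by rewrite subrK; lra.
Qed.

End C0_functions.

(** * Lattice homomorphisms from [C0] to the reals *)

Section Riesz.
Variables (R : realType) (Omega : topologicalType).
Hypothesis Omega_lc : locally_compact [set: Omega].
Hypothesis Omega_hausdorff : hausdorff_space Omega.
Implicit Types (f g h : C0 R Omega) (w x y : Omega).

(** The bump is [1 - f], with [f] equal to 1 off [U] and off a compact neighbourhood [K] of [x];
    vanishing off [K] puts it in [C0]. *)
Lemma c0_urysohn x (U : set Omega) : nbhs x U ->
  exists f : C0 R Omega, [/\ f x = 1, (forall w, 0 <= f w),
    (forall w, f w <= 1) & forall w, ~ U w -> f w = 0].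
Proof.
move=> Ux; have := Omega_lc (x := x) I; rewrite withinET => -[K Kx [cK clK]].
have clB : closed (~` (U `&` K)°) by exact/open_closedC/open_interior.
have nBx : ~ (~` (U `&` K)°) x by apply; exact: filterI.
have /(@uniform_separatorP _ R)[f [cf f01 fx fB]] :=
  @locally_compact_completely_regular _ R Omega_lc Omega_hausdorff
    x _ clB nBx.
have f1 w : ~ (U `&` K) w -> f w = 1.
  move=> UKw; apply: fB; exists w => //.
  by apply: contra_not UKw => /interior_subset.
have fge0 w : 0 <= f w.
  by have := f01 (f w) (imageT f w); rewrite /= in_itv/= => /andP[].
have fle1 w : f w <= 1.
  by have := f01 (f w) (imageT f w); rewrite /= in_itv/= => /andP[].
have c1f : continuous (fun w => 1 - f w).
  by move=> w; apply: cvgB; [exact: cvg_cst|exact: cf].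
have fc0 : (fun w => 1 - f w) \in @c0_pred R Omega.
  apply/c0_predP; split=> // e e0; apply: (subclosed_compact _ cK).
    have c1nf : continuous (fun w => `|1 - f w|).
      by move=> w; apply: cvg_norm; exact: c1f.
    exact: (continuous_closedP (fun w => `|1 - f w|)).1 c1nf _ (@closed_ge _ e).
  move=> w /= ew; apply: contrapT => Kw; move: ew.
  by rewrite f1 ?subrr ?normr0 ?leNgt ?e0// => -[].
exists (C0Fun fc0); split=> [|w|w|w Uw] /=.
- by rewrite (fx (f x)) ?subr0//; exists x.
- by rewrite subr_ge0.
- by rewrite gerBl.
- by rewrite f1 ?subrr// => -[].
Qed.

(* The points where the kernel of [l] does not vanish cannot exhaust [Omega]:
   otherwise every [g >= 0] would satisfy [g <= M h + e sqrt g] with [l h = 0]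
   for each [e > 0], hence [l g <= e l (sqrt g)] and [l g = 0]. The square root
   replaces an appeal to the continuity of [l]. *)
Lemma lattice_functional_eval (l : C0 R Omega -> R) : scalar l ->
  {morph l : f g / (f `|` g)%O >-> Num.max f g} -> (exists f, l f != 0) ->
  exists x, exists2 a, 0 < a & forall f, l f = a * f x.
Proof.
move=> ll lj [f0 lf0].
have l0 : l 0 = 0.
  by have := ll (-1) 0 0; rewrite scaler0 addr0 => ->; rewrite mulN1r addNr.
have lZ a f : l (a *: f) = a * l f by rewrite -[a *: f]addr0 ll l0 addr0.
have lN f : l (- f) = - l f by rewrite -scaleN1r lZ mulN1r.
have lD f g : l (f + g) = l f + l g by rewrite -[f]scale1r ll lZ mul1r.
have le_l f g : (forall w, f w <= g w) -> l f <= l g.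
  move=> fg; have <- : (f `|` g)%O = g.
    apply/val_inj/funext => w.
    by have := c0_joinE f g w; rewrite (max_r (fg w)).
  by rewrite lj le_max lexx.
pose nrm f : C0 R Omega := (f `|` (- f))%O.
have nrmE f w : nrm f w = `|f w| by rewrite c0_joinE -[(- f) w]/(- f w) maxrN.
have lnrm f : l (nrm f) = `|l f| by rewrite lj lN maxrN.
(* If the kernel of [l] lies in that of evaluation at [x], the two functionals are proportional; the
   factor is [l h] for any [h] with [h x = 1]. *)
suff [x kx] : exists x, forall f, l f = 0 -> f x = 0.
  have fE f : l f * f0 x = l f0 * f x.
    have : (f - (l f / l f0) *: f0) x = 0.
      by apply: kx; rewrite lD lN lZ divfK ?subrr.
    rewrite -[LHS]/(f x - l f / l f0 * f0 x) => /eqP.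
    rewrite subr_eq0 => /eqP ->.
    by field.
  have [h [hx h0 _ _]] := @c0_urysohn x setT filterT.
  have := fE h; rewrite hx mulr1 => lhf0.
  have lh : l h != 0 by apply: contraNneq lf0 => lh0; rewrite -lhf0 lh0 mul0r.
  have lh0 : 0 <= l h by rewrite -l0; apply: le_l.
  exists x, (l h); first by rewrite lt_neqAle eq_sym lh.
  move=> f; have := fE f; rewrite -lhf0 => E.
  have f0x : f0 x != 0 by apply: contraNneq lf0 => E0; rewrite -lhf0 E0 mulr0.
  by apply: (mulIf f0x); rewrite E; ring.
apply: contrapT => /forallNP kN.
(* Scaling to the value 2 at [x] makes [1 < h] persist on a neighbourhood of [x]. *)
have ker x : exists h, [/\ l h = 0, (forall w, 0 <= h w) & 1 < h x].
  have /existsNP[f /not_implyP[lf /eqP fx]] := kN x.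
  exists ((2 / `|f x|) *: nrm f); split.
  - by rewrite lZ lnrm lf normr0 mulr0.
  - move=> w; rewrite -[_ w]/(2 / `|f x| * nrm f w) nrmE.
    by rewrite mulr_ge0// divr_ge0.
  - by rewrite -[_ x]/(2 / `|f x| * nrm f x) nrmE divfK ?normr_eq0// ltr1n.
pose D : set (C0 R Omega) := [set h | l h = 0 /\ forall w, 0 <= h w].
(* The nonnegative kernel elements are directed by join; near-covering compactness along this filter
   replaces a finite subcover and a finite join. *)
pose F := filter_from D
  (fun h => [set k | D k /\ forall w, h w <= k w]).
have FF : Filter F.
  apply: filter_from_filter; first by exists 0; split.
  move=> h k [lh h0] [lk k0]; exists (h `|` k)%O.
    by split=> [|w]; rewrite ?lj ?lh ?lk ?maxxx// c0_joinE le_max h0.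
  by move=> j [Dj jhk]; split; split=> // w; apply: le_trans (jhk w);
    rewrite c0_joinE le_max lexx ?orbT.
have cover (K : set Omega) : compact K ->
    exists h, D h /\ forall w, K w -> 1 <= h w.
  move=> /compact_near_coveringP/(_ _ F (fun k w => 1 <= k w) FF)[].
    move=> x _; have [h [lh h0 hx]] := ker x.
    exists ([set w | 1 < h w], [set k | D k /\ forall w, h w <= k w]).
      split; last by exists h.
      exact: (@c0_continuous R Omega h x) (lt_nbhsr hx).
    by move=> [w k] /= [hw [_ hk]]; exact: le_trans (ltW hw) (hk w).
  by move=> h Dh hK; exists h; split=> //; apply: hK; split.
have lg0 g : (forall w, 0 <= g w) -> l g <= 0.
  move=> g0; pose k : C0 R Omega := C0Fun (c0_sqrt g0).
  have lk : 0 <= l k by rewrite -l0; apply: le_l => w; exact: sqrtr_ge0.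
  apply/ler_addgt0Pl => e e0; rewrite addr0.
  (* Chosen so that [d * l k <= e]; the [+ 1] keeps the denominator positive. *)
  pose d := e / (l k + 1).
  have d0 : 0 < d by rewrite divr_gt0// ltr_wpDl.
  have /c0_predP[_ /(_ _ (exprn_gt0 2 d0))/cover[h [[lh h0] hK]]] := c0_funP g.
  have : l g <= l (c0_norm g *: h + d *: k).
    apply: le_l => w.
    rewrite -[leRHS]/(c0_norm g * h w + d * Num.sqrt (g w)).
    (* Where [d ^+ 2 <= g w], the multiple of [h] dominates because [1 <= h w]; elsewhere
       [sqrt (g w) < d] bounds [g w] by [d * sqrt (g w)]. *)
    have [dg|gd] := leP (d ^+ 2) (g w).
      rewrite (@le_trans _ _ (c0_norm g * h w))//; last first.
        by rewrite lerDl mulr_ge0 ?sqrtr_ge0// ltW.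
      rewrite (@le_trans _ _ (c0_norm g))//.
        by rewrite (le_trans (ler_norm _))// c0_norm_ub.
      by rewrite ler_peMr ?c0_norm_ge0// hK//= ger0_norm.
    rewrite -[leLHS]add0r lerD ?mulr_ge0 ?c0_norm_ge0//.
    rewrite -{1}(sqr_sqrtr (g0 w)) expr2 ler_wpM2r ?sqrtr_ge0//.
    by rewrite -(ger0_norm (ltW d0)) -sqrtr_sqr ler_wsqrtr// ltW.
  move=> /le_trans; apply; rewrite lD !lZ lh mulr0 add0r /d mulrAC -mulrA.
  by rewrite ler_piMr ?(ltW e0)// ler_pdivrMr ?mul1r ?lerDl// ltr_wpDl.
have : `|l f0| <= 0 by rewrite -lnrm lg0// => w; rewrite nrmE.
by rewrite normr_le0; apply/negP.
Qed.

(** A bump at [x] vanishing at [y] would force [a = 0]. This makes the point and the weight of an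
    automorphism well defined. *)
Lemma eval_inj (a b : R) x y : 0 < a -> 0 < b ->
  (forall f, a * f x = b * f y) -> x = y /\ a = b.
Proof.
move=> a0 b0 ab; suff xy : x = y.
  split=> //; subst y; have [f [fx _ _ _]] := @c0_urysohn x setT filterT.
  by have := ab f; rewrite fx !mulr1.
apply: contrapT => /eqP xy.
have := Omega_hausdorff; rewrite open_hausdorff => /(_ x y xy).
move=> [[U V] /= [/set_mem Ux /set_mem Vy] [oU oV UV0]].
have Unx : nbhs x U by exact: open_nbhs_nbhs.
have [f [fx _ _ fU]] := c0_urysohn Unx.
have := ab f; rewrite fx fU ?mulr0 ?mulr1.
  by move=> a00; rewrite a00 ltxx in a0.
by move=> Uy; have : (U `&` V) y by []; rewrite (eqP UV0).
Qed.

End Riesz.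

(** * Initial topologies *)

Section Initial.
Variables (S : choiceType) (T : topologicalType) (f : S -> T).

Lemma continuous_to_initial (X : topologicalType)
    (r : X -> initial_topology f) :
  continuous (f \o r : X -> T) -> continuous r.
Proof.
move=> cfr; apply/continuousP => _ [A oA <-].
by rewrite -comp_preimage; exact: (continuousP (f \o r)).1 cfr _ oA.
Qed.

(** Push the filter forward by [f]: it clusters at some [f a] with [A a], and since open sets are
    preimages, the original filter clusters at [a]. *)
Lemma compact_initial (A : set (initial_topology f)) :
  compact (f @` A : set T) -> compact A.
Proof.
move=> cfA F FF FA.
have [|_ [[a Aa <-] cla]] := cfA (f @ F) _.
  exact: filterS (@preimage_image _ _ f A) FA.
exists a; split=> // B C FB.
rewrite nbhsE => -[_ [[D oD <-] Da] DC].
have := cla (f @` B) D; case.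
- exact: filterS (@preimage_image _ _ f B) FB.
- exact: open_nbhs_nbhs.
- by move=> _ [[b Bb <-] Db]; exists b; split=> //; exact: DC.
Qed.

End Initial.

(** * The strong operator topology *)

Section Strong_topology.
Variables (R : realType) (Omega : topologicalType).
Implicit Types (f : C0 R Omega).

Lemma aut_eval_continuous f :
  continuous (fun T : latAut R Omega => T f).
Proof.
move=> T; apply: (@continuous_comp _ _ _ (@aut_ptws R Omega) (fun g => g f)).
  exact: initial_continuous.
exact: (@proj_continuous _ (fun=> C0 R Omega) f).
Qed.

Lemma continuous_to_aut (X : topologicalType) (r : X -> latAut R Omega) :
  (forall f, continuous (fun x => r x f)) -> continuous r.
Proof.
move=> cr; apply: continuous_to_initial => x.
by apply/pointwise_cvgP => f; exact: cr.
Qed.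

(** The norm controls [T f - U f] at all points at once; passing through [T f z] separates the
    change of operator from the change of point. *)
Lemma aut_apply_continuous f :
  continuous (fun p : latAut R Omega * Omega => p.1 f p.2).
Proof.
move=> [T w]; apply/cvgrPdist_lt => e e0.
have e2 : 0 < e / 2 by rewrite divr_gt0.
have /cvgrPdist_lt/(_ _ e2) nT := @aut_eval_continuous f T.
have /cvgrPdist_lt/(_ _ e2) nw := @c0_continuous _ _ (T f) w.
exists ([set U : latAut R Omega | `|T f - U f| < e / 2],
        [set z | `|T f w - T f z| < e / 2]) => //.
move=> [U z] /= [UT zw].
have : `|T f z - U f z| <= `|T f - U f| by exact: (c0_norm_ub (T f - U f) z).
have := ler_normD (T f w - T f z) (T f z - U f z).
rewrite subrKA; lra.
Qed.

End Strong_topology.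

(** * Automorphisms as weighted compositions *)

Section Weighted_composition.
Variables (R : realType) (Omega : topologicalType).
Hypothesis Omega_lc : locally_compact [set: Omega].
Hypothesis Omega_hausdorff : hausdorff_space Omega.
Implicit Types (f g h : C0 R Omega) (w x y : Omega) (T U : latAut R Omega).

Let urysohn := @c0_urysohn R Omega Omega_lc Omega_hausdorff.

Lemma aut_eval_weighted T w :
  exists xa : Omega * R, 0 < xa.2 /\ forall f, T f w = xa.2 * f xa.1.
Proof.
have [] := @lattice_functional_eval R Omega Omega_lc Omega_hausdorff
  (fun f => T f w).
- by move=> a f g; rewrite aut_linear.
- by move=> f g; rewrite aut_join c0_joinE.
(* The functional is nonzero because [T] is onto. *)
- have [h [hw _ _ _]] := @urysohn w setT filterT.
  by exists (aut_inv T h); rewrite aut_invK hw oner_neq0.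
- by move=> x [a a0 Tx]; exists (x, a).
Qed.

(** The pair is picked by choice; [aut_point_weight_unique] shows that it is the only one. *)
Definition aut_weight T w : R := (sval (cid (aut_eval_weighted T w))).2.
Definition aut_point T w : Omega := (sval (cid (aut_eval_weighted T w))).1.

Lemma aut_weight_gt0 T w : 0 < aut_weight T w.
Proof. by rewrite /aut_weight; case: cid => ? []. Qed.

Lemma autE T f w : T f w = aut_weight T w * f (aut_point T w).
Proof. by rewrite /aut_weight /aut_point; case: cid => ? []. Qed.

Lemma aut_point_weight_unique T w a x : 0 < a ->
  (forall f, T f w = a * f x) -> aut_point T w = x /\ aut_weight T w = a.
Proof.
move=> a0 Ta; apply: (@eval_inj R Omega) => //; first exact: aut_weight_gt0.
by move=> f; rewrite -autE.
Qed.

Lemma aut_mulE T U w : aut_point (T * U)%g w = aut_point U (aut_point T w) /\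
  aut_weight (T * U)%g w = aut_weight T w * aut_weight U (aut_point T w).
Proof.
apply: aut_point_weight_unique => [|f].
  by rewrite mulr_gt0// aut_weight_gt0.
by rewrite -mulrA -autE -autE.
Qed.

Lemma aut_oneE w : aut_point 1%g w = w /\ aut_weight 1%g w = 1.
Proof. by apply: aut_point_weight_unique => // f; rewrite mul1r. Qed.

(** For a bump [f] at [aut_point T w] vanishing off [U], the open condition [0 < V f z] forces
    [aut_point V z] into [U]. *)
Lemma aut_point_continuous :
  continuous (fun p : latAut R Omega * Omega => aut_point p.1 p.2).
Proof.
move=> [T w] U /= Ux; have [f [fx f0 _ fU]] := urysohn Ux.
have : 0 < T f w by rewrite autE fx mulr1 aut_weight_gt0.
move=> /lt_nbhsr/(@aut_apply_continuous _ _ f (T, w)).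
rewrite -[X in X -> _]/(nbhs (T, w) (fun p => 0 < p.1 f p.2)).
rewrite -[X in _ -> X]/(nbhs (T, w) (fun p => U (aut_point p.1 p.2))).
apply: filterS => -[V z] /=; rewrite autE => Vf; apply: contrapT => /fU fz.
by rewrite fz mulr0 ltxx in Vf.
Qed.

(** Near [(T, w)] the weight is a quotient of continuous functions: [V f z] divided by the value of
    a bump [f] at [aut_point V z]. *)
Lemma aut_weight_continuous :
  continuous (fun p : latAut R Omega * Omega => aut_weight p.1 p.2).
Proof.
move=> [T w]; have [f [fx f0 _ _]] := @urysohn (aut_point T w) setT filterT.
have cf : continuous (fun p : latAut R Omega * Omega => f (aut_point p.1 p.2)).
  move=> p; apply: (continuous_comp (@aut_point_continuous p)).
  exact: c0_continuous.
have lim : (fun p : latAut R Omega * Omega =>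
    p.1 f p.2 / f (aut_point p.1 p.2)) @ (T, w) --> aut_weight T w.
  have -> : aut_weight T w = T f w / f (aut_point T w).
    by rewrite autE fx divr1 mulr1.
  apply: cvgM; first exact: (@aut_apply_continuous R Omega f (T, w)).
  by apply: cvgV; [rewrite fx oner_neq0|exact: (cf (T, w))].
apply: cvg_trans lim; apply: near_eq_cvg.
have : 0 < f (aut_point T w) by rewrite fx.
move=> /lt_nbhsr/(cf (T, w)).
rewrite -[X in X -> _]/(nbhs (T, w) (fun p => 0 < f (aut_point p.1 p.2))).
apply: filterS => -[V z] /= fz.
by rewrite autE mulfK// gt_eqF.
Qed.

(* Gliding hump: if the weights of [T_n] exceed [(n+1)^2] at [w_n], the values
   [T_n F w_n] are unbounded for [F := sup_n f_n / (n+1)], where [0 <= f_n <= 1]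
   peaks at the point read by [T_n] at [w_n]. *)
Lemma aut_weight_bounded (H : set (latAut R Omega)) :
  (forall f, exists M, forall T w, H T -> T f w <= M) ->
  exists M, forall T w, H T -> aut_weight T w <= M.
Proof.
move=> Hbnd; apply: contrapT => /forallNP Hunb.
have /choice[Tw TwP] (n : nat) : exists Tw : latAut R Omega * Omega,
    H Tw.1 /\ n.+1%:R ^+ 2 < aut_weight Tw.1 Tw.2.
  have /existsNP[T /existsNP[w /not_implyP[HT /negP]]] := Hunb (n.+1%:R ^+ 2).
  by rewrite -ltNge => Tw; exists (T, w).
have /choice[h hP] (n : nat) : exists h : C0 R Omega,
    [/\ h (aut_point (Tw n).1 (Tw n).2) = 1, (forall w, 0 <= h w) &
        forall w, h w <= 1].
  have [h [hx h0 h1 _]] :=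
    @urysohn (aut_point (Tw n).1 (Tw n).2) setT filterT.
  by exists h.
have hle n w : h n w / n.+1%:R <= n.+1%:R^-1.
  by have [_ _ h1] := hP n; rewrite ler_piMl.
pose F w := sup (range (fun n => h n w / n.+1%:R)).
have Fub w : has_ubound (range (fun n => h n w / n.+1%:R)).
  exists 1 => _ [n _ <-]; rewrite (le_trans (hle n w))//.
  by rewrite invf_le1 ?ltr0n// ler1n.
have leF n w : h n w / n.+1%:R <= F w by apply: ub_le_sup => //; exists n.
have F0 w : 0 <= F w.
  by have [_ h0 _] := hP 0%N; apply: le_trans (leF 0%N w); rewrite divr_ge0.
(* Finite joins stay in [C0] and approximate [F], which is so far a mere function. *)
have partial N : exists g, (forall w, 0 <= g w <= F w) /\
    forall n w, (n < N)%N -> h n w / n.+1%:R <= g w.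
  elim: N => [|N [g [gF hg]]]; first by exists 0; split=> // w; rewrite lexx F0.
  exists (g `|` (N.+1%:R^-1 *: h N))%O; split=> [w|n w].
    have /andP[g0 gFw] := gF w; rewrite c0_joinE le_max g0 ge_max gFw.
    by rewrite c0_scaleE mulrC leF.
  rewrite ltnS leq_eqVlt => /orP[/eqP ->|nN]; rewrite c0_joinE le_max.
    by rewrite c0_scaleE mulrC lexx orbT.
  by rewrite hg.
have Fc0 : F \in @c0_pred R Omega.
  apply: c0_uniform_limit => e e0.
  (* Terms of index at least [N] are at most [1 / (N + 1) < e]; the earlier ones lie below [g]. *)
  have [N _ /(_ N (leqnn N)) Ne] := near_infty_natSinv_lt (PosNum e0).
  have [g [gF hg]] := partial N; exists g => w; have /andP[g0 gFw] := gF w.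
  rewrite ger0_norm ?subr_ge0// lerBlDl; apply: ge_sup.
    by exists (h 0%N w / 1%:R), 0%N.
  move=> _ [n _ <-]; have [nN|Nn] := ltnP n N.
    by rewrite (le_trans (hg _ _ nN))// lerDl ltW.
  rewrite (le_trans (hle n w))// -[leLHS]add0r lerD// (le_trans _ (ltW Ne))//.
  by rewrite lef_pV2 ?posrE ?ltr0n// ler_nat ltnS.
have [M MP] := Hbnd (C0Fun Fc0).
(* The value of [T_N F] at [w_N] is at least [(N + 1) ^ 2 / (N + 1) = N + 1]. *)
have [N] : exists N : nat, M < N.+1%:R.
  by exists (Num.truncn M); rewrite truncnS_gt.
apply/negP; rewrite -leNgt.
have [HN wN] := TwP N; have [hN _ _] := hP N.
apply: le_trans (MP (Tw N).1 (Tw N).2 HN); rewrite autE /=.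
apply: (@le_trans _ _ (N.+1%:R ^+ 2 *
    (h N (aut_point (Tw N).1 (Tw N).2) / N.+1%:R))).
  by rewrite hN div1r expr2 mulfK.
by rewrite ler_pM// ?divr_ge0 ?hN// ltW.
Qed.

Lemma aut_weight_bounded1 T : exists M, forall w, aut_weight T w <= M.
Proof.
have [|M MP] := @aut_weight_bounded [set T].
  move=> f; exists (c0_norm (T f)) => _ w ->.
  by rewrite (le_trans (ler_norm _))// c0_norm_ub.
by exists M => w; exact: MP.
Qed.

(** For each [f] the orbit of [f] under [H] is norm compact, hence bounded. *)
Lemma aut_weight_bounded_compact (H : set (latAut R Omega)) : compact H ->
  exists M, forall T w, H T -> aut_weight T w <= M.
Proof.
move=> cH; apply: aut_weight_bounded => f.
have cHf : {within H, continuous (fun T : latAut R Omega => T f)}.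
  exact/continuous_subspaceT/aut_eval_continuous.
have /compact_bounded[M [_ MP]] := continuous_compact cHf cH.
exists (M + 1) => T w HT; rewrite (le_trans (ler_norm _))//.
rewrite (le_trans (c0_norm_ub (T f) w))//.
by apply: (MP (M + 1)); [rewrite ltrDl|exists T].
Qed.

(** Automatic continuity: a bound on the weight of [T] bounds its operator norm. *)
Lemma aut_continuous T : continuous T.
Proof.
have [M MP] := aut_weight_bounded1 T.
have M1 : 0 < `|M| + 1 by rewrite ltr_wpDl.
move=> f; apply/(@cvgrPdist_le _ _ _ _ (nbhs_filter f)) => e e0.
have eM : 0 < e / (`|M| + 1) by rewrite divr_gt0.
have := @nbhsx_ballx _ _ f _ eM; apply: filterS => g.
rewrite -ball_normE => /ltW fg; apply: c0_norm_le => [|w]; first exact: ltW.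
rewrite -[(T f - T g) w]/(T f w - T g w) !autE -mulrBr normrM.
rewrite (gtr0_norm (aut_weight_gt0 _ _)) mulrC.
apply: (@le_trans _ _ (e / (`|M| + 1) * (`|M| + 1))); last first.
  by rewrite divfK ?gt_eqF.
apply: ler_pM => //; first exact/ltW/aut_weight_gt0.
  exact: le_trans (c0_norm_ub (f - g) (aut_point T w)) fg.
by rewrite (le_trans (MP w))// (le_trans (ler_norm _))// lerDl.
Qed.

Lemma aut_mul2_continuous T U :
  continuous (fun V : latAut R Omega => (T * V * U)%g).
Proof.
apply: continuous_to_aut => f V.
apply: (@continuous_comp _ _ _ (fun V : latAut R Omega => V (U f)) T).
  exact: aut_eval_continuous.
exact: aut_continuous.
Qed.

Lemma aut_point_continuous1 T : continuous (aut_point T).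
Proof.
move=> w; apply: (@continuous_comp _ _ _ (pair T)
  (fun p : latAut R Omega * Omega => aut_point p.1 p.2)).
  by apply: (@cvg_pair _ _ _ _ (nbhs T) (nbhs w) _ _ _ (fun=> T) id);
    [exact: cvg_cst|exact: cvg_id].
exact: aut_point_continuous.
Qed.

Lemma aut_pointK T : cancel (aut_point T) (aut_point T^-1%g).
Proof.
move=> w; rewrite -(aut_mulE T T^-1%g w).1 mulgV.
exact: (aut_oneE w).1.
Qed.

(** [aut_point] reverses products and a homeomorphism acts through its inverse, so [aut_point T] is
    the inverse map; this makes [aut_homeo] multiplicative. *)
Definition aut_homeo T : Homeo Omega :=
  MkHomeo (@aut_point_continuous1 T^-1%g) (@aut_point_continuous1 T)
    (fun w => etrans (congr1 (fun U => aut_point U (aut_point T^-1%g w))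
      (esym (invgK T))) (aut_pointK T^-1%g w))
    (@aut_pointK T).

Lemma aut_homeoM T U : aut_homeo (T * U)%g = (aut_homeo T * aut_homeo U)%g.
Proof. by apply: homeoP => w /=; rewrite invgM (aut_mulE U^-1%g _ w).1. Qed.

Lemma aut_homeo_weighted T (a : Omega -> R) (p : Homeo Omega) :
  (forall w, 0 < a w) -> (forall f w, T f w = a w * f (homeo_inv p w)) ->
  aut_homeo T = p.
Proof.
move=> a0 Ta; have pt w : aut_point T w = homeo_inv p w.
  by have [] := @aut_point_weight_unique T w (a w) (homeo_inv p w).
apply: homeoP => w; rewrite -{1}(homeo_funK p w) -pt.
exact: (homeo_invK (aut_homeo T)).
Qed.

(** Conjugation by [m] changes only the weight, from 1 to [m w / m (homeo_inv p w)]. *)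
Lemma aut_homeo_conj (m : Cbpp R Omega) (p : Homeo Omega) :
  aut_homeo (mul_aut m * homeo_aut R p * (mul_aut m)^-1)%g = p.
Proof.
apply: (@aut_homeo_weighted _ (fun w => m w / m (homeo_inv p w))) => [w|f w].
  by rewrite divr_gt0// cbpp_gt0.
by rewrite -mulrA.
Qed.

Lemma homeo_autK : cancel (@homeo_aut R Omega) aut_homeo.
Proof.
move=> p; apply: (@aut_homeo_weighted _ (fun=> 1)) => // f w.
by rewrite mul1r.
Qed.

(** * The supremum of the weights over a compact set *)

Section Supremum.
Variable H : set (latAut R Omega).
Hypotheses (H_compact : compact H) (H1 : H 1%g).

Definition sup_weight w := sup [set aut_weight T w | T in H].

Lemma sup_weight_ub T w : H T -> aut_weight T w <= sup_weight w.
Proof.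
move=> HT; apply: ub_le_sup; last by exists T.
have [M MP] := aut_weight_bounded_compact H_compact.
by exists M => _ [U HU <-]; exact: MP.
Qed.

Lemma sup_weight_le w (M : R) : (forall T, H T -> aut_weight T w <= M) ->
  sup_weight w <= M.
Proof.
move=> HM; apply: ge_sup; first by exists (aut_weight 1%g w), 1%g.
by move=> _ [T HT <-]; exact: HM.
Qed.

(** By the cocycle identity, as [U |-> T U] permutes [H]; stability under [T] and under [T^-1] gives
    one inequality each. *)
Lemma sup_weightM T w : (forall U, H U -> H (T * U)%g) ->
  (forall U, H U -> H (T^-1 * U)%g) ->
  sup_weight w = aut_weight T w * sup_weight (aut_point T w).
Proof.
move=> HT HTV; have T0 := aut_weight_gt0 T w.
apply/le_anti/andP; split.
  apply: sup_weight_le => U HU.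
  rewrite -[U](mulVKg T) (aut_mulE T _ w).2 ler_pM2l//.
  exact/sup_weight_ub/HTV.
rewrite -ler_pdivlMl//; apply: sup_weight_le => U HU.
rewrite ler_pdivlMl// -(aut_mulE T U w).2.
exact/sup_weight_ub/HT.
Qed.

(** Compactness of [H] turns joint continuity into equicontinuity of the weights at [w], which
    passes to their supremum. *)
Lemma sup_weight_continuous : continuous sup_weight.
Proof.
move=> w; apply/cvgrPdist_le => e e0.
have /compact_near_coveringP/(_ _ (nbhs w)
  (fun z T => `|aut_weight T w - aut_weight T z| <= e) _) near_cov := H_compact.
have {near_cov} : \forall z \near w,
    H `<=` (fun T => `|aut_weight T w - aut_weight T z| <= e).
  apply: near_cov => T HT.
  (* Both [(U, w)] and [(U, z)] are compared with [(T, w)], hence the half. *)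
  have e2 : 0 < e / 2 by rewrite divr_gt0.
  have /cvgrPdist_le/(_ _ e2) [[A B] /= [TA wB] AB] :=
    @aut_weight_continuous (T, w).
  exists (A, B) => // -[U z] /= [AU Bz].
  have := AB (U, w) (conj AU (nbhs_singleton wB)).
  have := AB (U, z) (conj AU Bz); rewrite /= => Uz Uw.
  have := ler_distD (aut_weight T w) (aut_weight U w) (aut_weight U z).
  rewrite (distrC (aut_weight U w) (aut_weight T w)); lra.
apply: filterS => z Hz; rewrite ler_distl; apply/andP; split.
  rewrite lerBlDr; apply: sup_weight_le => T HT.
  have := sup_weight_ub w HT; have := Hz _ HT; rewrite ler_distl; lra.
apply: sup_weight_le => T HT.
have := sup_weight_ub z HT; have := Hz _ HT; rewrite ler_distl; lra.
Qed.

Lemma sup_weight_bounded : [bounded sup_weight w | w in [set: Omega]].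
Proof.
have [M MP] := aut_weight_bounded_compact H_compact.
exists M; split=> [|N MN w _]; first exact: num_real.
rewrite /= ger0_norm; last first.
  by rewrite (le_trans _ (sup_weight_ub w H1))// ltW// aut_weight_gt0.
by rewrite (le_trans _ (ltW MN))//; apply: sup_weight_le => T /MP.
Qed.

(** The bound 1 is the weight of the identity, which belongs to [H]. *)
Lemma sup_weight_ge : exists2 d : R, 0 < d & forall w, d <= sup_weight w.
Proof.
by exists 1 => // w; rewrite -{1}(aut_oneE w).2 sup_weight_ub.
Qed.

Definition sup_weight_cbpp : Cbpp R Omega :=
  MkCbpp sup_weight_continuous sup_weight_bounded sup_weight_ge.

End Supremum.
End Weighted_composition.

(** * Conjugation by a multiplication operator *)

Section Conjugation.
Variables (R : realType) (Omega : topologicalType).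
Hypothesis Omega_lc : locally_compact [set: Omega].
Hypothesis Omega_hausdorff : hausdorff_space Omega.

Lemma homeo_aut_continuous :
  continuous (@homeo_aut R Omega : homeo_s R Omega -> latAut R Omega).
Proof. exact: initial_continuous. Qed.

Lemma group_morphism1 (G H : groupType) (r : G -> H) : group_morphism r ->
  r 1%g = 1%g.
Proof. by move=> rM; apply: (mulIg (r 1%g)); rewrite -rM !mul1g. Qed.

Lemma group_morphismV (G H : groupType) (r : G -> H) s : group_morphism r ->
  r s^-1%g = (r s)^-1%g.
Proof.
move=> rM; apply: (mulIg (r s)).
by rewrite -rM !mulVg group_morphism1.
Qed.

Variables (G : groupType) (m : Cbpp R Omega).
Implicit Types (pi : G -> homeo_s R Omega) (rho : G -> latAut R Omega).

Lemma conj_rep_morphism pi : group_morphism pi ->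
  group_morphism (conj_rep m pi).
Proof.
move=> piM s t; rewrite /conj_rep piM homeo_autM !mulgA.
by rewrite mulgVK.
Qed.

Lemma homeo_aut_conj_rep pi s :
  homeo_aut R (pi s) = ((mul_aut m)^-1 * conj_rep m pi s * mul_aut m)%g.
Proof. by rewrite /conj_rep !mulgA mulVg mul1g mulgVK. Qed.

Lemma compact_conj (A : set (latAut R Omega)) T U : compact A ->
  compact [set (T * V * U)%g | V in A].
Proof.
apply: continuous_compact; apply: continuous_subspaceT.
exact: aut_mul2_continuous.
Qed.

(** By [compact_initial] it is enough that the operators of [pi] form a compact set, and they are a
    conjugate of the range of [rho]. *)
Lemma compact_range_homeo rho pi : (forall s, rho s = conj_rep m pi s) ->
  compact (range rho) -> compact (range pi).
Proof.
move=> rhoE /(@compact_conj _ (mul_aut m)^-1%g (mul_aut m)) crho.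
apply: compact_initial; congr compact: crho.
rewrite -[range pi]/(pi @` setT) !image_comp; apply: eq_imagel => s _ /=.
by rewrite rhoE homeo_aut_conj_rep.
Qed.

Lemma compact_range_conj_rep pi : compact (range pi) ->
  compact (range (conj_rep m pi)).
Proof.
move=> cpi; have chpi : compact ((@homeo_aut R Omega) @` range pi).
  apply: continuous_compact cpi.
  exact/continuous_subspaceT/homeo_aut_continuous.
have := @compact_conj _ (mul_aut m) (mul_aut m)^-1%g chpi; congr compact.
by rewrite !image_comp.
Qed.

End Conjugation.

(** * The correspondence, strong continuity and order equivalence *)

Theorem theorem6p5 (R : realType) (Omega : topologicalType)
    (Omega_lc : locally_compact [set: Omega])
    (Omega_hausdorff : hausdorff_space Omega) :
  [/\ (forall (G : groupType) (rho : G -> latAut R Omega),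
        group_morphism rho -> compact (range rho) ->
        exists pi : G -> homeo_s R Omega,
          [/\ group_morphism pi,
              (exists m : Cbpp R Omega, forall s : G, rho s = conj_rep m pi s),
              compact (range pi) &
              forall pi' : G -> homeo_s R Omega,
                group_morphism pi' ->
                (exists m' : Cbpp R Omega,
                  forall s : G, rho s = conj_rep m' pi' s) ->
                pi' = pi]),
      (forall (G : groupType) (pi : G -> homeo_s R Omega) (m : Cbpp R Omega),
        group_morphism pi -> compact (range pi) ->
        group_morphism (conj_rep m pi) /\ compact (range (conj_rep m pi))),
      (forall (G : topologicalGroupType) (rho : G -> latAut R Omega)
          (pi : G -> homeo_s R Omega) (m : Cbpp R Omega),
        group_morphism rho -> compact (range rho) ->
        group_morphism pi -> (forall s : G, rho s = conj_rep m pi s) ->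
        (continuous rho <-> continuous pi)) &
      (forall (G : groupType) (rho1 rho2 : G -> latAut R Omega)
          (pi1 pi2 : G -> homeo_s R Omega) (m1 m2 : Cbpp R Omega),
        group_morphism rho1 -> compact (range rho1) ->
        group_morphism rho2 -> compact (range rho2) ->
        group_morphism pi1 -> compact (range pi1) ->
        group_morphism pi2 -> compact (range pi2) ->
        (forall s : G, rho1 s = conj_rep m1 pi1 s) ->
        (forall s : G, rho2 s = conj_rep m2 pi2 s) ->
        (order_equivalent rho1 rho2 <->
         isometrically_order_equivalent
           (fun s : G => homeo_aut R (pi1 s))
           (fun s : G => homeo_aut R (pi2 s))))].
Proof.
have conj_cont (T U : latAut R Omega) :
    continuous (fun V : latAut R Omega => (T * V * U)%g).
  exact: aut_mul2_continuous.
split.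
- move=> G rho rhoM crho; pose pi s : homeo_s R Omega :=
    aut_homeo Omega_lc Omega_hausdorff (rho s).
  have rho1 : range rho 1%g by exists 1%g; rewrite ?group_morphism1.
  pose m := sup_weight_cbpp Omega_lc Omega_hausdorff crho rho1.
  have rhoE s : rho s = conj_rep m pi s.
    apply: autP => f; apply/val_inj/funext => w.
    rewrite -[LHS]/(rho s f w) (autE Omega_lc Omega_hausdorff).
    rewrite -[RHS]/(m w * ((m (homeo_inv (pi s) w))^-1 *
      f (homeo_inv (pi s) w))) mulrA; congr (_ * _).
    (* The range of [rho] is stable under left translation by [rho s] and its inverse, so
       [sup_weightM] applies. *)
    have mE : m w = aut_weight Omega_lc Omega_hausdorff (rho s) w *
        m (homeo_inv (pi s) w).
      apply: sup_weightM => // _ [t _ <-]; first by exists (s * t)%g.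
      by exists (s^-1 * t)%g; rewrite // rhoM group_morphismV.
    by rewrite mE mulfK// gt_eqF// cbpp_gt0.
  exists pi; split.
  + by move=> s t; rewrite /pi rhoM aut_homeoM.
  + by exists m.
  + exact: (compact_range_homeo Omega_lc Omega_hausdorff rhoE crho).
  (* Whatever [m'] is, [aut_homeo] recovers [pi'] from [rho]. *)
  + move=> pi' _ [m' rhoE']; apply/funext => s.
    by rewrite /pi rhoE' /conj_rep aut_homeo_conj.
- move=> G pi m piM cpi; split; first exact: conj_rep_morphism.
  exact: compact_range_conj_rep.
- move=> G rho pi m _ _ _ rhoE; split=> [crho|cpi].
  + apply: continuous_to_initial => s.
    have -> : @homeo_aut R Omega \o pi =
        (fun V => (mul_aut m)^-1 * V * mul_aut m)%g \o rho.
      by apply/funext => t /=; rewrite rhoE (homeo_aut_conj_rep m).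
    by apply: continuous_comp; [exact: crho|exact: conj_cont].
  + have -> : rho = (fun V => mul_aut m * V * (mul_aut m)^-1)%g \o
        (@homeo_aut R Omega \o pi) by apply/funext => t; rewrite rhoE.
    move=> s; apply: continuous_comp; last exact: conj_cont.
    by apply: continuous_comp; [exact: cpi|exact: homeo_aut_continuous].
- move=> G rho1 rho2 pi1 pi2 m1 m2 _ _ _ _ _ _ _ _ rho1E rho2E.
  split=> [[T TE]|[T _ TE]].
  (* Undoing the multipliers gives an intertwiner [S], possibly weighted. As [aut_homeo] is
     multiplicative and a left inverse of [homeo_aut], the homeomorphism of [S] intertwines too, and
     it acts isometrically. *)
  + have [S SE] : exists S : latAut R Omega, forall s,
        (S * homeo_aut R (pi1 s) = homeo_aut R (pi2 s) * S)%g.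
      exists ((mul_aut m2)^-1 * T * mul_aut m1)%g => s.
      rewrite (homeo_aut_conj_rep m1) (homeo_aut_conj_rep m2) -rho1E -rho2E.
      by rewrite !mulgA !mulgK -(mulgA _ T (rho1 s)) TE !mulgA.
    pose p : homeo_s R Omega := aut_homeo Omega_lc Omega_hausdorff S.
    exists (homeo_aut R p); first exact: homeo_aut_isometric.
    move=> s; rewrite -!homeo_autM; congr homeo_aut.
    have := congr1 (aut_homeo Omega_lc Omega_hausdorff) (SE s).
    by rewrite !aut_homeoM !homeo_autK.
  + exists (mul_aut m2 * T * (mul_aut m1)^-1)%g => s.
    rewrite rho1E rho2E /conj_rep !mulgA !mulgVK.
    by rewrite -(mulgA _ T (homeo_aut _ _)) TE !mulgA.
Qed.
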